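(* The second-price auction (SPA) is risk-averse auto-bidding incentive compatible (RAIC) in the setting of two uniform bidding tCPA auto-bidders. That is: let there be two advertisers $A=\{1,2\}$ and $n\ge1$ queries with values $v_{i,j}>0$. For each advertiser $i\in\{1,2\}$ with true target $T_i>0$, every fixed reported target of the other advertiser (a positive real), and every report $0<T_i'\le T_i$, $$\min_{\pi\in\Pi(T_i)^{\mathrm{Eq}}}\mathrm{LW}_i(\pi)\ \ge\ \min_{\pi\in\Pi(T_i')^{\mathrm{Eq}}}\mathrm{LW}_i(\pi),$$ where $\Pi(\cdot)^{\mathrm{Eq}}$ is the set of uniform-bidding equilibrium allocations.
   Context: Setting. There are two advertisers $1,2$ and queries $Q=\{1,\dots,n\}$; $v_{i,j}>0$ is the value of bidder $i$ for query $j$. Each advertiser $i$ reports a target to its own auto-bidder. Uniform bidding: with reported targets $(S_1,S_2)$, bidder $i$ chooses a single multiplier $\mu_i\ge1$ and bids $b_{i,j}=\mu_iS_iv_{i,j}$ on every query $j$. Second-price auction: each query $j$ is sold separately to the highest bidder on $j$, and ties are won by bidder 1; the winner pays the other bidder's bid on $j$. $\pi_{i,j}\in\{0,1\}$ indicates whether $i$ wins $j$, and $c_{i,j}$ is the price $i$ pays for $j$ when winning it. Uniform-bidding auto-bidder equilibrium with reported targets $(S_1,S_2)$: multipliers $\mu_1,\mu_2\ge1$, with resulting allocation $\pi$ and costs $c$, such that for each bidder $i$: (1) tCPA constraint: $\sum_{j}\pi_{i,j}c_{i,j}\le S_i\sum_j\pi_{i,j}v_{i,j}$; (2) stability: for every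 deviation of $i$ to uniform bids $b'_{i,j}=\alpha'v_{i,j}$ with $\alpha'>0$, the other bidder's bids being unchanged, with resulting allocation $\pi'$ and costs $c'$, at least one of the following holds: $S_i\sum_j\pi'_{i,j}v_{i,j}\le S_i\sum_j\pi_{i,j}v_{i,j}$, or $\sum_j\pi'_{i,j}c'_{i,j}>S_i\sum_j\pi'_{i,j}v_{i,j}$. With the other advertiser's report fixed, $\Pi(S)^{\mathrm{Eq}}$ denotes the set of allocations of uniform-bidding auto-bidder equilibria when advertiser $i$ reports $S$. $\mathrm{LW}_i(\pi)=T_i\sum_{j}\pi_{i,j}v_{i,j}$, where $T_i$ is the true target of $i$ (used on both sides). Convention: the minimum over an empty set is $+\infty$. *)

(* Defs.v *)
From HB Require Import structures.
From mathcomp Require Import all_boot all_order all_algebra.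
From mathcomp Require Import boolp classical_sets reals constructive_ereal.

Set Implicit Arguments.
Unset Strict Implicit.
Unset Printing Implicit Defensive.

Import Order.TTheory GRing.Theory Num.Theory.
Local Open Scope ring_scope.

(* Advertisers 1 and 2 are [ord0] and [ord_max] in ['I_2], and
   row [i] of a [2 x n] matrix of values, bids or prices belongs to
   advertiser [i]. *)

Definition other (i : 'I_2) : 'I_2 := rev_ord i.

Section SecondPriceAuction.
Variables (R : realType) (n : nat).
Implicit Types (v b : 'M[R]_(2, n)) (S mu : 'I_2 -> R) (pi : 'M[bool]_(2, n)).

Definition uniform_bids v S mu : 'M[R]_(2, n) :=
  \matrix_(i, j) (mu i * S i * v i j).

(* Ties go to advertiser 1. *)
Definition spa_alloc b : 'M[bool]_(2, n) :=
  \matrix_(i, j) (if i == ord0 then b (other i) j <= b i j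
                  else b (other i) j < b i j).

(* The entry at [(i, j)] is only meaningful when [i] wins [j]. *)
Definition spa_price b : 'M[R]_(2, n) := \matrix_(i, j) b (other i) j.

Definition won_value v pi (i : 'I_2) : R := \sum_j (pi i j)%:R * v i j.

Definition payment b (i : 'I_2) : R :=
  \sum_j (spa_alloc b i j)%:R * spa_price b i j.

Definition deviate v b (i : 'I_2) (a : R) : 'M[R]_(2, n) :=
  \matrix_(k, j) (if k == i then a * v k j else b k j).

Definition tcpa_feasible v S b (i : 'I_2) : Prop :=
  payment b i <= S i * won_value v (spa_alloc b) i.

Definition stable v S b (i : 'I_2) : Prop :=
  forall a : R, 0 < a ->
    let b' := deviate v b i a in
    S i * won_value v (spa_alloc b') i <= S i * won_value v (spa_alloc b) i \/
    payment b' i > S i * won_value v (spa_alloc b') i.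

Definition uniform_equilibrium v S mu : Prop :=
  (forall i, 1 <= mu i) /\
  forall i, tcpa_feasible v S (uniform_bids v S mu) i /\
            stable v S (uniform_bids v S mu) i.

Definition eq_allocs v S : set 'M[bool]_(2, n) :=
  [set pi | exists mu, uniform_equilibrium v S mu /\
                       pi = spa_alloc (uniform_bids v S mu)].

Definition reports (i : 'I_2) (own rival : R) : 'I_2 -> R :=
  fun k => if k == i then own else rival.

(* [T] is the true target of [i], whatever [i] reports. *)
Definition LW v (i : 'I_2) (T : R) pi : R := T * won_value v pi i.

(* There are finitely many allocations, so this is a genuine minimum, equal to
   [+oo] when there is no equilibrium. *)
Definition min_eq_LW v (i : 'I_2) (T own rival : R) : \bar R :=
  \big[Order.min/+oo%E]_(pi | pi \in eq_allocs v (reports i own rival))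
    (LW v i T pi)%:E.

End SecondPriceAuction.

(* Main.v *)
(* Write x and y for the values of the bidder under study and of the rival, s
   and t for their reports.  Under uniform bidding a bidder wins an upper set P
   for the ratios x_j / y_j, so equilibria are described by chains of sets.
   With rho(P) = x(P) / y(P), a nontrivial upper set P is an equilibrium share
   iff, for its neighbours P- and P+ in the chain of upper sets,
     s rho(~P) <= t,  s rho(P+) rho(~P) < t x_j / y_j for j in P     (capped),
     t <= s rho(P),   t x_j / y_j < s rho(P) rho(~P-) for j not in P (floored);
   the empty share is one iff s rho(all) <= t and the full share iff
   s rho(all) >= t.  Lowering s preserves "capped", and when P is capped but not
   floored then P- is again capped.  Descending from an equilibrium share for
   the higher report therefore reaches an equilibrium share for the lower one,
   unless s rho(all) <= t, in which case the empty share is an equilibrium. *)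
Require Import Defs.
From HB Require Import structures.
From mathcomp Require Import all_boot all_order all_algebra.
From mathcomp Require Import boolp classical_sets reals constructive_ereal.
From mathcomp Require Import fintype finset lra.

Set Implicit Arguments.
Unset Strict Implicit.
Unset Printing Implicit Defensive.

Import Order.TTheory GRing.Theory Num.Theory.
Local Open Scope ring_scope.


(** Turns finitely many strict bounds into one admissible number; either list may be empty. When a
    new lower bound reaches the old separator, a fresh one is built just above it by taking minima
    with midpoints. *)
Lemma separate_seqs (R : realFieldType) (s t : seq R) :
  {in s & t, forall x y, x < y} ->
  exists z, {in s, forall x, x < z} /\ {in t, forall y, z < y}.
Proof.
elim: s => [|x s IHs] st.
  elim: t {st} => [|y t [z [_ zt]]]; first by exists 0.
  exists (Num.min z (y - 1)); split=> // u; rewrite inE => /predU1P[->|ut].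
    by rewrite gt_min; apply/orP; right; lra.
  by rewrite gt_min zt.
have [|z [sz zt]] := IHs; first by move=> u w us wt; rewrite st// inE us orbT.
have [xz|zx] := ltP x z.
  by exists z; split=> // u; rewrite inE => /predU1P[->//|/sz].
have : {in t, forall y, x < y} by move=> y yt; rewrite st ?inE ?eqxx.
elim: t {st IHs zt} => [|y t IHt] xt.
  exists (x + 1); split=> // u; rewrite inE => /predU1P[->|/sz uz]; lra.
have [|w [sw wt]] := IHt; first by move=> u ut; rewrite xt// inE ut orbT.
have xy : x < y by rewrite xt ?inE ?eqxx.
have xw : x < w by rewrite sw ?inE ?eqxx.
have xm : x < Num.min w ((x + y) / 2) by rewrite lt_min xw; lra.
exists (Num.min w ((x + y) / 2)); split=> u; rewrite inE => /predU1P[->|us]//.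
- exact: lt_trans (lt_le_trans (sz _ us) zx) xm.
- by rewrite gt_min; apply/orP; right; lra.
- by rewrite gt_min wt.
Qed.

(** * Weights, their ratios and upper sets *)

Definition weight (R : nmodType) (J : finType) (f : J -> R) (P : {set J}) : R :=
  \sum_(j in P) f j.

Definition weight_ratio (R : fieldType) (J : finType) (x y : J -> R)
  (P : {set J}) : R := weight x P / weight y P.

(** The inequality is strict, so queries of equal ratio are all inside or all outside; this makes
    upper sets a chain. *)
Definition upper (R : numFieldType) (J : finType) (x y : J -> R)
    (P : {set J}) : bool :=
  [forall i in P, forall j, (j \notin P) ==> (x j / y j < x i / y i)].

Lemma setC_neq0 (J : finType) (P : {set J}) : (~: P != set0) = (P != [set: J]).
Proof. by rewrite -setCT (inj_eq (@setC_inj _)). Qed.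

Lemma proper_neq0 (J : finType) (P Q : {set J}) : P \proper Q -> Q != set0.
Proof. by apply: contraTneq => ->; rewrite /proper sub0set andbF. Qed.

Lemma proper_neqT (J : finType) (P Q : {set J}) : P \proper Q -> P != [set: J].
Proof. by apply: contraTneq => ->; rewrite /proper subsetT andbF. Qed.

Section Ratios.
Variables (R : realFieldType) (J : finType).
Implicit Types (x y : J -> R) (P Q : {set J}).

Lemma upperP x y P :
  reflect (forall i j, i \in P -> j \notin P -> x j / y j < x i / y i)
          (upper x y P).
Proof.
apply: (iffP forall_inP) => [uP i j iP jP|uP i iP].
  by have /forallP/(_ j)/implyP := uP i iP; apply.
by apply/forallP => j; apply/implyP; exact: uP.
Qed.

Lemma upper_comparable x y P Q :
  upper x y P -> upper x y Q -> (P \subset Q) || (Q \proper P).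
Proof.
move=> /upperP uP /upperP uQ; have [//|/subsetPn[i iP iQ]] := boolP (P \subset Q).
rewrite properE; apply/andP; split; last by apply/subsetPn; exists i.
apply/subsetP => j jQ; apply: contraT => jP.
by have := lt_trans (uP i j iP jP) (uQ j i jQ iQ); rewrite ltxx.
Qed.

Lemma weight_gt0 x P : (forall j, 0 < x j) -> P != set0 -> 0 < weight x P.
Proof.
move=> x0 /set0Pn[i iP]; rewrite /weight (bigD1 i)//=.
by rewrite ltr_wpDr// sumr_ge0// => j _; exact: ltW.
Qed.

Lemma weight_ge0 x P : (forall j, 0 < x j) -> 0 <= weight x P.
Proof. by move=> x0; rewrite sumr_ge0// => j _; exact: ltW. Qed.

Lemma ltr_weight x y P : P != set0 -> {in P, forall j, x j < y j} ->
  weight x P < weight y P.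
Proof.
move=> /set0Pn[i iP] xy; apply: ltr_sum => //.
by apply/hasP; exists i => //; rewrite mem_index_enum.
Qed.

Lemma weight_scale c x P : weight (fun j => c * x j) P = c * weight x P.
Proof. by rewrite /weight mulr_sumr. Qed.

Lemma ratio_inv x y j : (x j / y j)^-1 = y j / x j.
Proof. by rewrite invf_div. Qed.

Lemma weight_ratio_inv x y P : (weight_ratio x y P)^-1 = weight_ratio y x P.
Proof. by rewrite /weight_ratio invf_div. Qed.

(** Inverting the ratios reverses their order. This is the symmetry that exchanges the two
    bidders. *)
Lemma upperC x y P : (forall j, 0 < x j) -> (forall j, 0 < y j) ->
  upper y x (~: P) = upper x y P.
Proof.
move=> x0 y0; apply/upperP/upperP => uP i j.
  move=> iP jP; have := uP j i; rewrite !inE jP negbK iP => /(_ isT isT).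
  by rewrite -!(ratio_inv x) ltf_pV2// posrE divr_gt0.
rewrite !inE negbK => iP jP; have := uP j i jP iP.
by rewrite -!(ratio_inv x) ltf_pV2// posrE divr_gt0.
Qed.

Variables (x y : J -> R).
Hypotheses (x0 : forall j, 0 < x j) (y0 : forall j, 0 < y j).

Lemma weight_ratio_gt0 P : P != set0 -> 0 < weight_ratio x y P.
Proof. by move=> P0; rewrite divr_gt0// weight_gt0. Qed.

Lemma lt_weight_ratio c P : P != set0 ->
  {in P, forall j, c < x j / y j} -> c < weight_ratio x y P.
Proof.
move=> P0 cP; rewrite ltr_pdivlMr ?weight_gt0// -weight_scale ltr_weight// => j jP.
by rewrite -ltr_pdivlMr// cP.
Qed.

Lemma weight_ratio_lt c P : P != set0 ->
  {in P, forall j, x j / y j < c} -> weight_ratio x y P < c.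
Proof.
move=> P0 cP; rewrite ltr_pdivrMr ?weight_gt0// -weight_scale ltr_weight// => j jP.
by rewrite -ltr_pdivrMr// cP.
Qed.

(** The ratio of [Q] is a mediant of those of [P] and [Q :\: P], and the least query ratio in [P]
    separates these two. *)
Lemma weight_ratio_lt_proper P Q : P != set0 -> P \proper Q ->
  (forall i j, i \in P -> j \in Q -> j \notin P -> x j / y j < x i / y i) ->
  weight_ratio x y Q < weight_ratio x y P.
Proof.
move=> P0 /properP[PQ [d dQ dP]] lt_PQ; have P0' := P0.
case/set0Pn: P0' => i0 i0P.
case: (arg_minP (P := mem P) (fun j => x j / y j) i0P) => i iP i_min.
have D0 : Q :\: P != set0 by apply/set0Pn; exists d; rewrite inE dP.
have lt_D : weight x (Q :\: P) < x i / y i * weight y (Q :\: P).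
  rewrite -weight_scale ltr_weight// => j; rewrite inE => /andP[jP jQ].
  by rewrite -ltr_pdivrMr// lt_PQ.
have le_P : x i / y i * weight y P <= weight x P.
  rewrite -weight_scale; apply: ler_sum => j jP.
  by rewrite -ler_pdivlMr//; exact: i_min.
have split_Q (f : J -> R) : weight f Q = weight f P + weight f (Q :\: P).
  by rewrite /weight (big_setID P)/= (setIidPr PQ).
have yP := weight_gt0 y0 P0; have yD := weight_gt0 y0 D0.
rewrite /weight_ratio !split_Q ltr_pdivrMr ?addr_gt0// mulrAC ltr_pdivlMr//.
rewrite mulrDl mulrDr ltrD2l.
apply: lt_le_trans (_ : x i / y i * weight y (Q :\: P) * weight y P <= _).
  by rewrite ltr_pM2r.
by rewrite mulrAC ler_pM2r.
Qed.

Lemma upper_weight_ratio_lt P Q : upper x y P -> P != set0 ->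
  P \proper Q -> weight_ratio x y Q < weight_ratio x y P.
Proof.
move=> /upperP uP P0 PQ; apply: weight_ratio_lt_proper => // i j iP _; exact: uP.
Qed.

End Ratios.

Section RatiosC.
Variables (R : realFieldType) (J : finType) (x y : J -> R).
Hypotheses (x0 : forall j, 0 < x j) (y0 : forall j, 0 < y j).
Implicit Types (P Q : {set J}).

(** This is [upper_weight_ratio_lt] with the bidders exchanged, for complements and inverse
    ratios. *)
Lemma upper_weight_ratioC_lt P Q : upper x y Q -> Q != [set: J] ->
  P \proper Q -> weight_ratio x y (~: Q) < weight_ratio x y (~: P).
Proof.
move=> uQ QT PQ.
have Q0 : ~: Q != set0 by rewrite setC_neq0.
have P0 : ~: P != set0 by rewrite setC_neq0 (proper_neqT PQ).
rewrite -[ltRHS]invrK -[ltLHS]invrK ltf_pV2 ?posrE ?invr_gt0 ?weight_ratio_gt0//.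
rewrite !weight_ratio_inv; apply: upper_weight_ratio_lt => //.
  by rewrite upperC.
by rewrite properC.
Qed.

End RatiosC.

(** * Best replies in terms of shares, and the descent along upper sets *)

Section BestReply.
Variables (R : realFieldType) (J : finType).
Implicit Types (x y : J -> R) (s t a b : R) (P Q : {set J}).

(** The rival bids [b * y j], so winning [Q] costs [b * weight y Q]. Only larger upper sets are
    tested, since shares form a chain and smaller ones bring no gain. *)
Definition best_reply x y s b P : Prop :=
  b * weight y P <= s * weight x P /\
  forall Q, upper x y Q -> P \proper Q -> s * weight x Q < b * weight y Q.

(** What remains of own stability and rival affordability once the bid scales are eliminated;
    [floored] does the same for own affordability and rival stability. *)
Definition capped x y s t P : Prop :=
  s * weight_ratio x y (~: P) <= t /\
  forall Q j, upper x y Q -> P \proper Q -> j \in P ->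
    s * weight_ratio x y Q * weight_ratio x y (~: P) < t * (x j / y j).

Definition floored x y s t P : Prop :=
  t <= s * weight_ratio x y P /\
  forall Q j, upper x y Q -> Q \proper P -> j \notin P ->
    t * (x j / y j) < s * weight_ratio x y P * weight_ratio x y (~: Q).

Variables (x y : J -> R).
Hypotheses (x0 : forall j, 0 < x j) (y0 : forall j, 0 < y j).

(** Own stability gives [s * weight_ratio x y Q < b], winning [j] gives [b <= a * (x j / y j)], and
    rival affordability gives [a * weight_ratio x y (~: P) <= t]. Chaining them removes [a] and
    [b]. *)
Lemma best_reply_capped s t a b P : 0 < s -> s <= a ->
    P != [set: J] -> {in P, forall j, b * y j <= a * x j} ->
    best_reply x y s b P -> best_reply y x t a (~: P) ->
  capped x y s t P.
Proof.
move=> s0 sa PT win [_ stab] [feas _].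
have C0 : ~: P != set0 by rewrite setC_neq0.
have rC := weight_ratio_gt0 x0 y0 C0.
have aC : a * weight_ratio x y (~: P) <= t.
  by rewrite mulrA ler_pdivrMr ?weight_gt0.
split=> [|Q j uQ PQ jP]; first by rewrite (le_trans _ aC)// ler_pM2r.
have Q0 := proper_neq0 PQ.
have sQ : s * weight_ratio x y Q < b.
  by rewrite mulrA ltr_pdivrMr ?weight_gt0// stab.
have bj : b <= a * (x j / y j) by rewrite mulrA ler_pdivlMr// win.
apply: lt_le_trans (_ : b * weight_ratio x y (~: P) <= _).
  by rewrite ltr_pM2r.
apply: le_trans (_ : a * (x j / y j) * weight_ratio x y (~: P) <= _).
  by rewrite ler_pM2r.
by rewrite mulrAC ler_pM2r// divr_gt0.
Qed.

Lemma cappedW s' s t P : s' <= s -> P != [set: J] ->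
  capped x y s t P -> capped x y s' t P.
Proof.
move=> s's PT [cap1 cap2].
have rC : 0 < weight_ratio x y (~: P) by rewrite weight_ratio_gt0// setC_neq0.
split=> [|Q j uQ PQ jP]; first by rewrite (le_trans _ cap1)// ler_pM2r.
apply: le_lt_trans (cap2 Q j uQ PQ jP); rewrite ler_pM2r// ler_pM2r//.
exact/weight_ratio_gt0/(proper_neq0 PQ).
Qed.

(** First the quotient [tau] of the bid scales [b] and [a] is chosen, then [a] itself. All
    constraints on [tau] are strict and finite in number, so pairwise compatibility suffices. *)
Lemma capped_floored_equilibrium s t P : 0 < s -> 0 < t ->
    upper x y P -> P != set0 -> P != [set: J] ->
    capped x y s t P -> floored x y s t P ->
  exists a b, [/\ s <= a, t <= b,
    {in P, forall j, b * y j < a * x j} & {in ~: P, forall j, a * x j < b * y j}] /\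
    (best_reply x y s b P /\ best_reply y x t a (~: P)).
Proof.
move=> s0 t0 /[dup] uP' /upperP uP P0 PT [cap1 cap2] [flo1 flo2].
have C0 : ~: P != set0 by rewrite setC_neq0.
set r := fun j => x j / y j; set rho := weight_ratio x y.
have rC : 0 < rho (~: P) by exact: weight_ratio_gt0.
have rP : 0 < rho P by exact: weight_ratio_gt0.
(* [sup] is own stability [s * rho Q < a * tau] at [a = t / rho (~: P)]; [inf] is rival stability
   [t < a * rho (~: Q)] at [a = s * rho P / tau]. *)
pose sup := [seq s * rho Q * rho (~: P) / t | Q : {set J} <-
   enum [pred Q : {set J} | upper x y Q & P \proper Q]].
pose inf := [seq s * rho P * rho (~: Q) / t | Q : {set J} <-
   enum [pred Q : {set J} | upper x y Q & Q \proper P]].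
have [|tau tau12] := @separate_seqs R ([seq r j | j <- enum (~: P)] ++ sup)
    ([seq r j | j <- enum P] ++ inf).
  move=> u w; rewrite !mem_cat.
  case/orP=> /mapP[j]; rewrite mem_enum => jP ->;
  case/orP=> /mapP[i]; rewrite mem_enum => iP ->.
  - by move: jP; rewrite inE => jP; exact: uP.
  - case/andP: iP => uQ QP; move: jP; rewrite inE => jP.
    by rewrite ltr_pdivlMr// mulrC flo2.
  - case/andP: jP => uQ PQ.
    by rewrite ltr_pdivrMr// [ltRHS]mulrC cap2.
  (* The two stability bounds are always compatible: [s * rho P * rho (~: P)] lies between them by
     monotonicity of the ratios. *)
  - case/andP: jP => uQ PQ; case/andP: iP => uQ' QP.
    rewrite ltr_pM2r ?invr_gt0//.
    apply: lt_trans (_ : s * rho P * rho (~: P) < _).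
      by rewrite ltr_pM2r// ltr_pM2l// (upper_weight_ratio_lt y0).
    rewrite ltr_pM2l ?(mulr_gt0 s0 rP)//.
    exact: (upper_weight_ratioC_lt x0 y0 uP').
case: tau12 => tau1 tau2.
have tauC : {in ~: P, forall j, r j < tau}.
  by move=> j jP; apply: tau1; rewrite mem_cat map_f ?mem_enum.
have tauP : {in P, forall j, tau < r j}.
  by move=> j jP; apply: tau2; rewrite mem_cat map_f ?mem_enum.
have tau_sup Q : upper x y Q -> P \proper Q -> s * rho Q * rho (~: P) < t * tau.
  move=> uQ PQ; rewrite [ltRHS]mulrC -ltr_pdivrMr// tau1// mem_cat; apply/orP; right.
  by apply/mapP; exists Q; rewrite // mem_enum inE uQ.
have tau_inf Q : upper x y Q -> Q \proper P -> t * tau < s * rho P * rho (~: Q).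
  move=> uQ QP; rewrite mulrC -ltr_pdivlMr// tau2// mem_cat; apply/orP; right.
  by apply/mapP; exists Q; rewrite // mem_enum inE uQ.
have tau0 : 0 < tau.
  have /set0Pn[j jC] := C0; apply: lt_trans (tauC j jC); exact: divr_gt0.
have rCtau : rho (~: P) < tau by exact: weight_ratio_lt.
have taurP : tau < rho P by exact: lt_weight_ratio.
(* The largest multiplier the rival can afford, or the one at which own
   affordability binds when the bids stay in the ratio tau. *)
pose a := Num.min (t / rho (~: P)) (s * rho P / tau).
have a0 : 0 < a by rewrite lt_min (divr_gt0 t0 rC) (divr_gt0 (mulr_gt0 s0 rP) tau0).
have sa : s <= a.
  rewrite le_min ler_pdivlMr// cap1/= ler_pdivlMr// ler_pM2l//.
  exact: ltW.
have tb : t <= a * tau.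
  rewrite -ler_pdivrMr// le_min ler_pM2l// lef_pV2 ?posrE// (ltW rCtau)/=.
  by rewrite ler_pM2r ?invr_gt0.
exists a, (a * tau); split; first split=> //.
- move=> j jP; rewrite -mulrA ltr_pM2l//; rewrite -ltr_pdivlMr//; exact: tauP.
- move=> j jP; rewrite -mulrA ltr_pM2l//; rewrite -ltr_pdivrMr//; exact: tauC.
split; split.
- rewrite -ler_pdivlMr ?weight_gt0// -mulrA -ler_pdivlMr//.
  by rewrite /a ge_min lexx orbT.
- move=> Q uQ PQ; have Q0 := proper_neq0 PQ.
  rewrite -ltr_pdivrMr ?weight_gt0// -mulrA -ltr_pdivrMr// lt_min; apply/andP; split.
    rewrite ltr_pdivrMr// mulrAC ltr_pdivlMr// -/(rho Q); exact: tau_sup.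
  by rewrite ltr_pM2r ?invr_gt0// ltr_pM2l// (upper_weight_ratio_lt y0).
- rewrite -ler_pdivlMr ?weight_gt0//.
  by rewrite -mulrA -/(weight_ratio y x (~: P)) -weight_ratio_inv ge_min lexx.
- move=> Q uQ PQ; have Q0 := proper_neq0 PQ.
  have uCQ : upper x y (~: Q) by rewrite -upperC// setCK.
  have QP : ~: Q \proper P by rewrite -properC setCK.
  rewrite -ltr_pdivrMr ?weight_gt0// -mulrA -/(weight_ratio y x Q) -weight_ratio_inv.
  rewrite lt_min; apply/andP; split.
    rewrite ltr_pM2l// ltf_pV2 ?posrE ?weight_ratio_gt0//.
    by have := upper_weight_ratioC_lt x0 y0 uP' PT QP; rewrite setCK.
  rewrite ltr_pdivrMr ?weight_ratio_gt0// mulrAC ltr_pdivlMr//.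
  by have := tau_inf _ uCQ QP; rewrite setCK.
Qed.

(** Induction on the size of [P]: either [P] is floored, or its predecessor in the chain is
    capped. *)
Lemma capped_descent s t P : 0 < s -> 0 < t ->
    t * weight y [set: J] < s * weight x [set: J] ->
    upper x y P -> P != [set: J] -> capped x y s t P ->
  exists Q, [/\ Q \subset P, upper x y Q, Q != set0, Q != [set: J] &
    capped x y s t Q /\ floored x y s t Q].
Proof.
move=> s0 t0 rich; have [m] := ubnP #|P|; elim: m P => // m IHm P Pm uP' PT capP.
have [cap1 cap2] := capP; have uP := upperP x y P uP'.
have T0 : [set: J] != set0.
  by apply: contraTneq rich => ->; rewrite /weight !big_set0 !mulr0 ltxx.
have rich' : t < s * weight_ratio x y [set: J].
  by rewrite mulrA ltr_pdivlMr ?weight_gt0.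
(* The descent never reaches the empty set, for which [cap1] would contradict [rich']. *)
have P0 : P != set0.
  by apply: contraTneq cap1 => ->; rewrite setC0 -ltNge.
have rP : 0 < weight_ratio x y P by exact: weight_ratio_gt0.
have P0' := P0; case/set0Pn: P0' => i0 i0P.
case: (arg_minP (P := mem P) (fun j => x j / y j) i0P) => i iP i_min.
(* Removing from [P] its class of lowest ratio gives the predecessor of [P] in the chain. *)
pose Q := [set j | x i / y i < x j / y j].
have uQ : upper x y Q.
  apply/upperP => k j; rewrite !inE -leNgt => ik ji; exact: le_lt_trans ik.
have QP : Q \proper P.
  apply/properP; split; last by exists i; rewrite // inE ltxx.
  apply/subsetP => j; rewrite inE => ij; apply: contraT => jP.
  by have := lt_trans ij (uP i j iP jP); rewrite ltxx.
have below Q' : upper x y Q' -> Q' \proper P -> Q' \subset Q.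
  move=> /upperP uQ' /properP[_ [k kP kQ']]; apply/subsetP => j jQ'.
  by rewrite inE (le_lt_trans (i_min k kP))// uQ'.
have above Q' : upper x y Q' -> Q \proper Q' -> P \subset Q'.
  move=> /upperP uQ' /properP[_ [k kQ']]; rewrite inE -leNgt => ki.
  apply/subsetP => j jP; apply: contraT => jQ'.
  have := le_lt_trans (i_min j jP) (lt_le_trans (uQ' k j kQ' jQ') ki).
  by rewrite ltxx.
have rQ : 0 < weight_ratio x y (~: Q).
  by rewrite weight_ratio_gt0// setC_neq0 (proper_neqT QP).
(* By monotonicity, flooring needs testing against [Q] only, the largest proper upper subset. *)
have [/forallP flo|] := boolP [forall j, (j \notin P) ==>
    (t * (x j / y j) < s * weight_ratio x y P * weight_ratio x y (~: Q))].
  exists P; split=> //; split=> //; split.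
    apply/ltW/(lt_trans rich'); rewrite ltr_pM2l// (upper_weight_ratio_lt y0)//.
    by rewrite properT.
  move=> Q' j uQ' QP' jP; have /implyP/(_ jP) := flo j; move/lt_le_trans; apply.
  have := below _ uQ' QP'; rewrite subEproper => /predU1P[->//|QQ].
  rewrite ler_pM2l ?(mulr_gt0 s0 rP)//; apply/ltW.
  by apply: (upper_weight_ratioC_lt x0 y0) => //; exact: proper_neqT QP.
(* The failing query [j] gives both halves of [capped] for [Q]: its ratio is below that of [P] as a
   whole and below that of each query of [Q]. *)
rewrite negb_forall => /existsP[j]; rewrite negb_imply -leNgt => /andP[jP le_j].
have jQ : x j / y j < weight_ratio x y P.
  by apply: lt_weight_ratio => // k kP; exact: uP.
have capQ : capped x y s t Q.
  split=> [|Q' k uQ' QQ' kQ].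
    rewrite -(ler_pM2l rP) mulrCA mulrA (le_trans le_j)// mulrC ler_pM2r//.
    exact: ltW.
  have PQ' := above _ uQ' QQ'.
  apply: le_lt_trans (_ : t * (x j / y j) < _).
    apply: le_trans le_j; rewrite ler_pM2r// ler_pM2l//.
    move: PQ'; rewrite subEproper => /predU1P[->//|PQ'].
    exact/ltW/(upper_weight_ratio_lt y0).
  by rewrite ltr_pM2l// uP// (subsetP (proper_sub QP)).
have [|Q' [Q'Q *]] := IHm Q _ uQ (proper_neqT QP) capQ.
  exact: leq_trans (proper_card QP) _.
by exists Q'; split=> //; exact: subset_trans (proper_sub QP).
Qed.

(* The price of the winner of everything does not depend on its own bid, so its
   multiplier can be raised until the rival can afford no query. *)
Lemma win_all_equilibrium s t : 0 < s -> 0 < t ->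
    t * weight y [set: J] <= s * weight x [set: J] ->
  exists a b, [/\ s <= a, t <= b & forall j, b * y j < a * x j] /\
    (best_reply x y s b [set: J] /\ best_reply y x t a set0).
Proof.
(* The sum dominates each threshold [t * y j / x j], and the summand [s] makes every win strict. *)
move=> s0 t0 rich; pose a := s + \sum_j t / (x j / y j).
have term_ge0 j : 0 <= t / (x j / y j) by rewrite ltW// !divr_gt0.
have win j : t * y j < a * x j.
  rewrite -ltr_pdivrMr// -mulrA -(invf_div (x j)) /a (bigD1 j)//=.
  by rewrite addrCA ltrDl ltr_pwDl// sumr_ge0.
exists a, t; split; first by split=> //; rewrite lerDl sumr_ge0.
split; split=> //.
- by move=> Q _ /proper_neqT; rewrite eqxx.
- by rewrite /weight !big_set0 !mulr0.
- move=> Q _ /proper_neq0 Q0; rewrite -!weight_scale; exact: ltr_weight.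
Qed.

End BestReply.

(** * Translation between auction equilibria and best replies *)

Section Bridge.
Variables (R : realType) (n : nat).
Implicit Types (v B : 'M[R]_(2, n)) (S mu : 'I_2 -> R) (i k : 'I_2).

Definition share B k : {set 'I_n} := [set j | spa_alloc B k j].

Lemma otherK : involutive other.
Proof. exact: rev_ordK. Qed.

Lemma ord2P i (Q : 'I_2 -> Prop) : Q i -> Q (other i) -> forall k, Q k.
Proof.
move=> Qi Qo k; have [->//|ki] := eqVneq k i; suff -> : k = other i by [].
apply: val_inj; move: ki; rewrite -val_eqE /=.
by case: i k {Qi Qo} => -[|[|//]] ? [[|[|//]] ?].
Qed.

Lemma other_neq i : (other i == i) = false.
Proof. by case: i => -[|[|//]]. Qed.

Lemma share_other B k : share B (other k) = ~: share B k.
Proof.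
apply/setP => j; rewrite !inE !mxE otherK.
case: k => -[|[|//]] ? /=; rewrite /eq_op/=; [exact: ltNge|exact: leNgt].
Qed.

Lemma share_win B k j : j \in share B k -> B (other k) j <= B k j.
Proof. by rewrite inE mxE; case: ifP => // _; exact: ltW. Qed.

Lemma share_lose B k j : j \notin share B k -> B k j <= B (other k) j.
Proof. by rewrite -in_setC -share_other => /share_win; rewrite otherK. Qed.

(** Strict gaps leave no ties, so the result is the same for either bidder. *)
Lemma share_eq B k (P : {set 'I_n}) :
  {in P, forall j, B (other k) j < B k j} ->
  {in ~: P, forall j, B k j < B (other k) j} -> share B k = P.
Proof.
move=> win lose; apply/setP => j; apply/idP/idP => [/share_win|jP].
  by apply: contraTT => jP; rewrite -ltNge lose// inE.
by apply: contraTT (win j jP) => /share_lose; rewrite -leNgt.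
Qed.

(** Winning means that the ratio passes the threshold [b / a], weakly for bidder 1 and strictly for
    bidder 2; both give upper sets. *)
Lemma share_upper B k (x y : 'I_n -> R) a b :
    (forall j, 0 < y j) -> 0 < a ->
    (forall j, B k j = a * x j) -> (forall j, B (other k) j = b * y j) ->
  upper x y (share B k).
Proof.
move=> y0 a0 Bk Bo.
have mem_share j : (j \in share B k) =
    if k == ord0 then b / a <= x j / y j else b / a < x j / y j.
  rewrite inE mxE Bk Bo ler_pdivrMr// ltr_pdivrMr// ![_ / _ * _]mulrAC.
  by rewrite ler_pdivlMr// ltr_pdivlMr// ![x j * _]mulrC.
apply/upperP => i j; rewrite !mem_share; case: ifP => _.
  by rewrite -ltNge => ri rj; exact: lt_le_trans ri.
by rewrite -leNgt => ri rj; exact: le_lt_trans ri.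
Qed.

Lemma won_value_share v B k :
  won_value v (spa_alloc B) k = weight (v k) (share B k).
Proof.
rewrite /weight big_mkcond; apply: eq_bigr => j _ /=.
by rewrite inE; case: (spa_alloc B k j); rewrite ?mul1r ?mul0r.
Qed.

Lemma payment_share B k (y : 'I_n -> R) b :
    (forall j, B (other k) j = b * y j) ->
  payment B k = b * weight y (share B k).
Proof.
move=> Bo; rewrite -weight_scale /weight big_mkcond; apply: eq_bigr => j _ /=.
by rewrite [spa_price _ _ _]mxE Bo inE; case: (spa_alloc B k j); rewrite ?mul1r ?mul0r.
Qed.

Variables (v : 'M[R]_(2, n)) (S : 'I_2 -> R).
Hypotheses (v0 : forall i j, 0 < v i j) (S0 : forall i, 0 < S i).

(** Every upper set is the share of some deviation, and every deviation yields an upper set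
    comparable with the current share. *)
Lemma best_replyP B k a b : 0 < a -> 0 < b ->
    (forall j, B k j = a * v k j) ->
    (forall j, B (other k) j = b * v (other k) j) ->
  (tcpa_feasible v S B k /\ stable v S B k) <->
  best_reply (v k) (v (other k)) (S k) b (share B k).
Proof.
move=> a0 b0 Bk Bo; rewrite /tcpa_feasible won_value_share (payment_share Bo).
have dev_k c j : deviate v B k c k j = c * v k j by rewrite mxE eqxx.
have dev_o c j : deviate v B k c (other k) j = b * v (other k) j.
  by rewrite mxE other_neq Bo.
split=> -[feas stab]; split=> //.
- move=> Q /upperP uQ PQ.
  pose r j := v k j / v (other k) j.
  (* The extra [0] forces [tau] to be positive even when [Q] is everything; scale [b / tau] then
     wins exactly the ratios above [tau]. *)
  have [|tau [tau1 tau2]] := @separate_seqs R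
      (0 :: [seq r j | j <- enum (~: Q)]) [seq r j | j <- enum Q].
    move=> _ _ /predU1P[->|/mapP[j + ->]] /mapP[i + ->]; rewrite !mem_enum.
      by by rewrite divr_gt0.
    by rewrite inE => jQ iQ; exact: uQ.
  have tau0 : 0 < tau by rewrite tau1 ?inE ?eqxx.
  have shareQ : share (deviate v B k (b / tau)) k = Q.
    apply: share_eq => j jQ; rewrite dev_k dev_o -mulrA ltr_pM2l//.
      by rewrite ltr_pdivlMl// -ltr_pdivlMr// -/(r j) tau2// map_f// mem_enum.
    rewrite ltr_pdivrMl// -ltr_pdivrMr// -/(r j) tau1// inE; apply/orP; right.
    by rewrite map_f// mem_enum.
  have /= := stab (b / tau) (divr_gt0 b0 tau0).
  rewrite !won_value_share (payment_share (dev_o _)) shareQ => -[|//].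
  rewrite ler_pM2l// leNgt => /negP[]; have [PsQ [d dQ dP]] := properP PQ.
  rewrite /weight [ltRHS](big_setID (share B k))/= (setIidPr PsQ) ltrDl.
  by apply: weight_gt0 => //; apply/set0Pn; exists d; rewrite inE dP.
- move=> c c0 /=; rewrite !won_value_share (payment_share (dev_o _)).
  have u1 := share_upper (v0 (other k)) c0 (dev_k c) (dev_o c).
  have u2 := share_upper (v0 (other k)) a0 Bk Bo.
  have /orP[sub|PQ] := upper_comparable u1 u2; [left|right; exact: stab].
  rewrite ler_pM2l// /weight [leRHS](big_setID (share (deviate v B k c) k))/=.
  by rewrite (setIidPr sub) lerDl weight_ge0.
Qed.

(** Dividing the bid scales by the reports recovers the multipliers, and the lower bounds on the
    scales make them at least 1. *)
Lemma equilibrium_share i (P : {set 'I_n}) a b :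
    S i <= a -> S (other i) <= b ->
    {in P, forall j, b * v (other i) j < a * v i j} ->
    {in ~: P, forall j, a * v i j < b * v (other i) j} ->
    best_reply (v i) (v (other i)) (S i) b P ->
    best_reply (v (other i)) (v i) (S (other i)) a (~: P) ->
  exists2 pi, pi \in eq_allocs v S & [set j | pi i j] = P.
Proof.
move=> Sa Sb win lose br_i br_o.
have a0 := lt_le_trans (S0 _) Sa; have b0 := lt_le_trans (S0 _) Sb.
pose mu k := (if k == i then a else b) / S k.
pose B := uniform_bids v S mu.
have Bi j : B i j = a * v i j by rewrite mxE /mu eqxx divfK ?gt_eqF.
have Bo j : B (other i) j = b * v (other i) j.
  by rewrite mxE /mu other_neq divfK ?gt_eqF.
have BP : share B i = P by apply: share_eq => j jP; rewrite Bi Bo; auto.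
exists (spa_alloc B) => //; apply/mem_set; exists mu; split=> //; split.
  by elim/(@ord2P i); rewrite /mu ?eqxx ?other_neq ler_pdivlMr// mul1r.
elim/(@ord2P i).
  by apply/(best_replyP a0 b0 Bi Bo); rewrite BP.
have Bi' j : B (other (other i)) j = a * v (other (other i)) j by rewrite otherK.
by apply/(best_replyP b0 a0 Bo Bi'); rewrite otherK share_other BP.
Qed.

Lemma equilibrium_best_replies i mu (B := uniform_bids v S mu) :
    uniform_equilibrium v S mu ->
  exists a b, [/\ S i <= a, S (other i) <= b,
    forall j, B i j = a * v i j, forall j, B (other i) j = b * v (other i) j &
    best_reply (v i) (v (other i)) (S i) b (share B i) /\
    best_reply (v (other i)) (v i) (S (other i)) a (~: share B i)].
Proof.
move=> [mu1 eqm]; exists (mu i * S i), (mu (other i) * S (other i)).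
have mu0 k : 0 < mu k * S k by rewrite mulr_gt0// (lt_le_trans _ (mu1 k)).
have BE k j : B k j = mu k * S k * v k j by rewrite mxE.
split=> //; rewrite ?ler_peMl ?(ltW (S0 _))//.
split; first exact/(best_replyP (mu0 _) (mu0 _) (BE i) (BE _))/eqm.
have /(best_replyP (mu0 _) (mu0 _) (BE _) (BE _)) := eqm (other i).
by rewrite otherK share_other.
Qed.

End Bridge.

(** * Shrinking an equilibrium share under a lower report, and the welfare comparison *)

Lemma smaller_equilibrium (R : realType) (n : nat) (v : 'M[R]_(2, n))
    (S S' : 'I_2 -> R) (i : 'I_2) pi :
    (0 < n)%N -> (forall i j, 0 < v i j) -> (forall k, 0 < S' k) ->
    S' i <= S i -> S' (other i) = S (other i) -> pi \in eq_allocs v S ->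
  exists2 pi', pi' \in eq_allocs v S' &
    [set j | pi' i j] \subset [set j | pi i j].
Proof.
move=> n0 v0 S'0 leS eqS; move=> /set_mem[mu [eqm ->]].
have S0 : forall k, 0 < S k.
  by elim/(@ord2P i); rewrite -?eqS// (lt_le_trans _ leS).
have T0 : [set: 'I_n] != set0 by apply/set0Pn; exists (Ordinal n0).
rewrite -/(share _ i); set P := share _ i.
have [a [b [Sa Sb Bi Bo [br_i br_o]]]] := equilibrium_best_replies v0 S0 i eqm.
have a0 := lt_le_trans (S0 _) Sa.
have [poor|rich] := leP (S' i * weight (v i) [set: 'I_n])
                        (S' (other i) * weight (v (other i)) [set: 'I_n]).
  (* Here the rival can take everything: the roles are exchanged, and [i] gets the empty share. *)
  have [b' [a' [[Sb' Sa' win] [br_o' br_i']]]] :=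
    win_all_equilibrium (v0 _) (v0 _) (S'0 _) (S'0 _) poor.
  have [|||pi' eq_pi' pi'0] :=
      equilibrium_share (P := set0) v0 S'0 Sa' Sb' _ _ br_i'.
  - by move=> j; rewrite inE.
  - by move=> j _; exact: win.
  - by rewrite setC0.
  by exists pi' => //; rewrite pi'0 sub0set.
(* The full share is treated apart: the capped condition needs a nonempty complement, and here any
   equilibrium is small enough. *)
have [PT|PT] := eqVneq P setT.
  have [a' [b' [[Sa' Sb' win] [br_i' br_o']]]] :=
    win_all_equilibrium (v0 _) (v0 _) (S'0 _) (S'0 _) (ltW rich).
  have [|||pi' eq_pi' _] :=
      equilibrium_share (P := setT) v0 S'0 Sa' Sb' _ _ br_i'.
  - by move=> j _; exact: win.
  - by move=> j; rewrite setCT inE.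
  - by rewrite setCT.
  by exists pi' => //; rewrite PT subsetT.
have uP : upper (v i) (v (other i)) P := share_upper (v0 _) a0 Bi Bo.
have win : {in P, forall j, b * v (other i) j <= a * v i j}.
  by move=> j; rewrite -Bi -Bo; exact: share_win.
have := best_reply_capped (v0 _) (v0 _) (S0 _) Sa PT win br_i br_o.
move=> /(cappedW (v0 _) (v0 _) leS PT); rewrite -eqS => capP.
have [Q [QP uQ Q0 QT [capQ floQ]]] :=
  capped_descent (v0 _) (v0 _) (S'0 _) (S'0 _) rich uP PT capP.
have [a' [b' [[Sa' Sb' winQ loseQ] [br_i' br_o']]]] :=
  capped_floored_equilibrium (v0 _) (v0 _) (S'0 _) (S'0 _) uQ Q0 QT capQ floQ.
have [pi' eq_pi' pi'Q] := equilibrium_share v0 S'0 Sa' Sb' winQ loseQ br_i' br_o'.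
by exists pi' => //; rewrite pi'Q.
Qed.

Theorem theorem4 (R : realType) (n : nat) (hn : (1 <= n)%N)
  (v : 'M[R]_(2, n)) (hv : forall i j, 0 < v i j)
  (i : 'I_2) (T : R) (hT : 0 < T)
  (rival : R) (hrival : 0 < rival)
  (T' : R) (hT'0 : 0 < T') (hT' : T' <= T) :
  (min_eq_LW v i T T rival >= min_eq_LW v i T T' rival)%E.
Proof.
(* Each truthful equilibrium is bounded separately; the default [+oo] covers the case where there is
   none. *)
apply: le_bigmin => [|pi eq_pi]; first exact: leey.
have rep_i s : reports i s rival i = s by rewrite /reports eqxx.
have rep_o s : reports i s rival (other i) = rival by rewrite /reports other_neq.
have [|||pi' eq_pi' sub] := smaller_equilibrium (i := i)
    (S' := reports i T' rival) hn hv _ _ _ eq_pi.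
- by elim/(@ord2P i); rewrite ?rep_i ?rep_o.
- by rewrite !rep_i.
- by rewrite !rep_o.
apply: (le_trans (bigmin_le_cond _ _ eq_pi')).
rewrite lee_fin ler_pM2l//; apply: ler_sum => j _; rewrite ler_pM2r// ler_nat.
by have /implyP := subsetP sub j; rewrite !inE; do 2!case: (_ i j).
Qed.
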